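(* Let $n\in\mathbb{N}$ and let $A$ be a positive semidefinite Hermitian $n\times n$ complex matrix. Then $$\gamma_+(A) = \inf\left\{ \int_{\Sigma_1^n}d\mu \;:\; A = \int_{\Sigma_1^n}xx^*\,d\mu(x),\ \mu \in \mathcal{B}_+(\Sigma_1^n) \right\},$$ and the infimum on the right-hand side is attained (i.e. it can be replaced by a minimum).
   Context: For a positive semidefinite Hermitian $n\times n$ matrix $A$, $\gamma_+(A) := \inf\{\sum_{k=1}^N \|x_k\|_1^2 : N\in\mathbb{N},\ x_k\in\mathbb{C}^n,\ A = \sum_{k=1}^N x_kx_k^*\}$, where $\|x\|_1=\sum_{i=1}^n|x(i)|$. $\Sigma_1^n=\{x\in\mathbb{C}^n:\|x\|_1=1\}$ is the $\ell_1$ unit sphere, and $\mathcal{B}_+(\Sigma_1^n)$ is the cone of (finite) positive Borel measures on $\Sigma_1^n$. Here $xx^*$ is the rank-one matrix with entries $x(i)\overline{x(j)}$, and the matrix-valued integral is taken entrywise. *)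

(* Defs.v *)
From HB Require Import structures.
From mathcomp Require Import all_boot all_order all_algebra.
From mathcomp Require Import complex.
From mathcomp Require Import all_classical all_reals all_analysis.

Set Implicit Arguments.
Unset Strict Implicit.
Unset Printing Implicit Defensive.

Import Order.TTheory GRing.Theory Num.Theory.
Import numFieldNormedType.Exports.

Local Open Scope classical_set_scope.
Local Open Scope sesquilinear_scope.
Local Open Scope complex_scope.
Local Open Scope ring_scope.

(* The metric topology of the field [R[i]] (open balls for the modulus); column
   vectors over [R[i]] then carry the library's product topology. *)
HB.instance Definition _ (R : realType) := NormedModule.copy R[i] R[i]^o.

Definition l1norm (R : realType) (n : nat) (x : 'cV[R[i]]_n) : R :=
  \sum_(i < n) ComplexField.Normc.normc (x i 0).

Definition psdmx (R : realType) (n : nat) (A : 'M[R[i]]_n) : Prop :=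
  A \is hermsymmx /\
  forall x : 'cV[R[i]]_n, 0 <= (x^t* *m A *m x) 0 0.

Definition rank1mx (R : realType) (n : nat) (x : 'cV[R[i]]_n) : 'M[R[i]]_n :=
  x *m x^t*.

Definition gamma_plus (R : realType) (n : nat) (A : 'M[R[i]]_n) : \bar R :=
  ereal_inf [set r | exists (N : nat) (x : 'I_N -> 'cV[R[i]]_n),
    A = \sum_(k < N) rank1mx (x k) /\
    r = (\sum_(k < N) l1norm (x k) ^+ 2)%:E].

Definition l1sphere (R : realType) (n : nat) : set 'cV[R[i]]_n :=
  [set x | l1norm x = 1].

(* The library's measurable types are pointed, while the unit sphere of the
   zero space is empty; hence the dimension [n.+1]. *)
Definition Sigma1 (R : realType) (n : nat) : Type :=
  set_type (@l1sphere R n.+1).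

Lemma l1sphere_delta (R : realType) (n : nat) :
  delta_mx 0 0 \in @l1sphere R n.+1.
Proof.
rewrite inE /l1sphere /= /l1norm (bigD1 0) //= big1 ?addr0.
  by rewrite mxE !eqxx ComplexField.Normc.normc1.
by move=> i i0; rewrite mxE (negbTE i0) ComplexField.Normc.normc0.
Qed.

HB.instance Definition _ (R : realType) (n : nat) :=
  Topological.on (Sigma1 R n).
HB.instance Definition _ (R : realType) (n : nat) :=
  isPointed.Build (Sigma1 R n) (SigSub (l1sphere_delta R n) : set_type (@l1sphere R n.+1)).

Definition borelSigma1 (R : realType) (n : nat) :=
  g_sigma_algebraType (@open (Sigma1 R n)).

Definition Sigma1_val (R : realType) (n : nat) (x : borelSigma1 R n) :
  'cV[R[i]]_n.+1 := set_val (x : set_type (@l1sphere R n.+1)).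

Section integral.
Context (d : measure_display) (T : measurableType d) (R : realType).
Variable mu : {measure set T -> \bar R}.

(* [Rintegral] is total; the entries of [x *m x^t*] are continuous and bounded
   on the sphere, hence integrable for every finite measure. *)
Definition Cintegral (f : T -> R[i]) : R[i] :=
  Rintegral mu setT (fun x => complex.Re (f x)) +i*
  Rintegral mu setT (fun x => complex.Im (f x)).

Definition mxintegral (m n : nat) (F : T -> 'M[R[i]]_(m, n)) :
  'M[R[i]]_(m, n) := \matrix_(i, j) Cintegral (fun x => F x i j).

End integral.

Definition represents (R : realType) (n : nat) (A : 'M[R[i]]_n.+1)
    (mu : {finite_measure set (borelSigma1 R n) -> \bar R}) : Prop :=
  A = mxintegral mu (fun x => rank1mx (Sigma1_val x)).

Definition total_mass (R : realType) (n : nat)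
    (mu : {finite_measure set (borelSigma1 R n) -> \bar R}) : \bar R :=
  (\int[mu]_x 1)%E.

(* Main.v *)
(* Finite decompositions of [A] are the finitely supported representing
   measures: an atom [x] becomes the mass [l1norm x ^+ 2] at [x / l1norm x].
   By Caratheodory's argument any finite sum of rank-one matrices can be
   rewritten with a fixed number of atoms without increasing the mass, so
   compactness yields an optimal finite decomposition (one exists at all by the
   spectral theorem).  Conversely, if [mu] represents [A] and has mass at most
   [M], project [A] onto the compact convex set of the sums of atoms of mass at
   most [M]: the variational inequality at the projection, integrated against
   [mu], forces the projection to be [A] itself.  Hence [A] has a finite
   decomposition of mass at most [M]. *)
From HB Require Import structures.
Require Import Defs.
From mathcomp Require Import all_boot all_order all_algebra.
From mathcomp Require Import complex.
From mathcomp Require Import all_classical all_reals all_analysis.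
From mathcomp Require Import measurable_realfun ring lra.

Import Order.TTheory GRing.Theory Num.Theory.
Import numFieldNormedType.Exports.

Local Open Scope classical_set_scope.
Local Open Scope sesquilinear_scope.
Local Open Scope complex_scope.
Local Open Scope ring_scope.

(** * Real coordinates of complex matrices and scaling of the l1 norm *)

Section RealCoordinates.
Context {R : realType}.
Implicit Types z w : R[i].

Lemma ReMconj z w : complex.Re (z * w^*)%R =
  complex.Re z * complex.Re w + complex.Im z * complex.Im w.
Proof. by case: z w => [a b] [c d] /=; rewrite mulrN opprK. Qed.

Lemma ImMconj z w : complex.Im (z * w^*)%R =
  complex.Im z * complex.Re w - complex.Re z * complex.Im w.
Proof. by case: z w => [a b] [c d] /=; rewrite mulrN addrC. Qed.

Lemma normcE z :
  ComplexField.Normc.normc z = Num.sqrt (complex.Re z ^+ 2 + complex.Im z ^+ 2).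
Proof. by case: z. Qed.

(** The boolean selects the imaginary part. These [2 n^2] real functionals turn matrix identities
    into real ones, so kernels, inner products and integrals are all taken over [R]. *)
Definition rcoord {n} (X : 'M[R[i]]_n) (j : 'I_n * 'I_n * bool) : R :=
  if j.2 then complex.Im (X j.1.1 j.1.2) else complex.Re (X j.1.1 j.1.2).

Lemma rcoord_inj n (X Y : 'M[R[i]]_n) : rcoord X =1 rcoord Y -> X = Y.
Proof.
move=> XY; apply/matrixP => i j; apply/eqP; rewrite eq_complex.
have := XY (i, j, false); have := XY (i, j, true).
by rewrite /rcoord /= => -> ->; rewrite !eqxx.
Qed.

Lemma rcoord0 n j : rcoord (0 : 'M[R[i]]_n) j = 0.
Proof. by rewrite /rcoord !mxE; case: ifP. Qed.

Lemma rcoordD n (X Y : 'M[R[i]]_n) j : rcoord (X + Y) j = rcoord X j + rcoord Y j.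
Proof. by rewrite /rcoord !mxE; case: (X _ _) (Y _ _) => [? ?] [? ?]; case: ifP. Qed.

Lemma rcoordB n (X Y : 'M[R[i]]_n) j : rcoord (X - Y) j = rcoord X j - rcoord Y j.
Proof. by rewrite /rcoord !mxE; case: (X _ _) (Y _ _) => [? ?] [? ?]; case: ifP. Qed.

Lemma rcoordZ n (a : R) (X : 'M[R[i]]_n) j : rcoord (a%:C *: X) j = a * rcoord X j.
Proof.
rewrite /rcoord !mxE; case: (X _ _) => [? ?]; case: ifP => _ /=; first by rewrite mul0r addr0.
by rewrite mul0r subr0.
Qed.

Lemma rcoord_sum n (I : Type) (r : seq I) (P : pred I) (F : I -> 'M[R[i]]_n) j :
  rcoord (\sum_(k <- r | P k) F k) j = \sum_(k <- r | P k) rcoord (F k) j.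
Proof. by apply: (big_morph (rcoord^~ j)) => [X Y|]; rewrite ?rcoordD ?rcoord0. Qed.

Lemma rank1mxE n (x : 'cV[R[i]]_n) i j : rank1mx x i j = (x i 0 * (x j 0)^*)%R.
Proof. by rewrite /rank1mx !mxE big_ord1 !mxE. Qed.

Lemma rank1mx0 n : rank1mx (0 : 'cV[R[i]]_n) = 0.
Proof. by rewrite /rank1mx mul0mx. Qed.

Lemma l1norm0 n : l1norm (0 : 'cV[R[i]]_n) = 0.
Proof. by rewrite /l1norm big1// => i _; rewrite mxE ComplexField.Normc.normc0. Qed.

Lemma normc_ge0 z : 0 <= ComplexField.Normc.normc z.
Proof. by rewrite normcE sqrtr_ge0. Qed.

Lemma l1norm_ge0 n (x : 'cV[R[i]]_n) : 0 <= l1norm x.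
Proof. by apply: sumr_ge0 => i _; exact: normc_ge0. Qed.

Lemma normc_le_l1norm n (x : 'cV[R[i]]_n) i :
  ComplexField.Normc.normc (x i 0) <= l1norm x.
Proof.
by rewrite /l1norm (bigD1 i) //= lerDl sumr_ge0// => k _; exact: normc_ge0.
Qed.

Lemma l1norm_eq0 n (x : 'cV[R[i]]_n) : l1norm x = 0 -> x = 0.
Proof.
move=> x0; apply/matrixP => i j; rewrite ord1 mxE.
apply: ComplexField.Normc.eq0_normc; apply/le_anti.
by rewrite normc_ge0 andbT -x0 normc_le_l1norm.
Qed.

Lemma l1normZ n (a : R) (x : 'cV[R[i]]_n) : 0 <= a ->
  l1norm (a%:C *: x) = a * l1norm x.
Proof.
move=> a0; rewrite /l1norm mulr_sumr; apply: eq_bigr => i _.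
by rewrite mxE ComplexField.Normc.normcM normcE /= expr0n addr0 sqrtr_sqr ger0_norm.
Qed.

(** Together with [rank1mx_sqrtZ]: a nonnegative weight is absorbed into an atom through its square
    root, scaling mass and matrix alike by [w]. *)
Lemma l1norm_sqrtZ n (w : R) (x : 'cV[R[i]]_n) : 0 <= w ->
  l1norm ((Num.sqrt w)%:C *: x) ^+ 2 = w * l1norm x ^+ 2.
Proof. by move=> w0; rewrite l1normZ ?sqrtr_ge0// exprMn sqr_sqrtr. Qed.

Lemma rank1mx_sqrtZ n (w : R) (x : 'cV[R[i]]_n) : 0 <= w ->
  rank1mx ((Num.sqrt w)%:C *: x) = w%:C *: rank1mx x.
Proof.
move=> w0; apply: rcoord_inj => -[[i j] b]; rewrite rcoordZ.
rewrite -[X in _ = X * _](sqr_sqrtr w0); move: (Num.sqrt w) => s.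
rewrite /rcoord /= !rank1mxE !ReMconj !ImMconj !mxE.
case: (x i 0) (x j 0) => [p q] [r t] /=.
by case: b => /=; ring.
Qed.

End RealCoordinates.

(** * Finite sums of rank-one matrices and Caratheodory reduction *)

Section Atoms.
Context {R : realType} {n : nat}.
Implicit Types A : 'M[R[i]]_n.

Definition atom_sum {N} (x : 'I_N -> 'cV[R[i]]_n) := \sum_(k < N) rank1mx (x k).
Definition atom_mass {N} (x : 'I_N -> 'cV[R[i]]_n) := \sum_(k < N) l1norm (x k) ^+ 2.

Lemma atom_drop N (x : 'I_N.+1 -> 'cV[R[i]]_n) k : x k = 0 ->
  atom_sum (x \o lift k) = atom_sum x /\ atom_mass (x \o lift k) = atom_mass x.
Proof.
move=> xk0; rewrite /atom_sum /atom_mass !(bigD1_ord k) //= xk0.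
by rewrite rank1mx0 l1norm0 expr0n !add0r.
Qed.

(* Move along a linear relation among the rank-one matrices, oriented so that
   the mass does not increase, until the first coefficient vanishes. *)
Lemma atom_vanish N (x : 'I_N -> 'cV[R[i]]_n) :
  (#|{: 'I_n * 'I_n * bool}| < N)%N ->
  exists (y : 'I_N -> 'cV[R[i]]_n) (k : 'I_N),
    [/\ y k = 0, atom_sum y = atom_sum x & atom_mass y <= atom_mass x].
Proof.
move=> ltN.
have [[k xk0]|xn0] := pselect (exists k, x k = 0); first by exists x, k.
(* One row per atom, one column per real coordinate: with more rows than columns, the left kernel is
   nonzero and yields the linear relation [c]. *)
pose M : 'M[R]_(N, _) := \matrix_(k < N, j < #|{: 'I_n * 'I_n * bool}|)
  rcoord (rank1mx (x k)) (enum_val j).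
have [c cM c0] : exists2 c : 'rV_N, c *m M = 0 & c != 0.
  have : kermx M != 0.
    rewrite kermx_eq0 -row_leq_rank -ltnNge.
    exact: leq_ltn_trans (rank_leq_col _) ltN.
  by move=> /rowV0Pn[c cM c0]; exists c => //; exact/sub_kermxP.
wlog sc : c cM c0 / 0 <= \sum_k c 0 k * l1norm (x k) ^+ 2.
  move=> wl; have [|lt0] := leP 0 (\sum_k c 0 k * l1norm (x k) ^+ 2).
    exact: wl.
  apply: (wl (- c)); rewrite ?mulNmx ?cM ?oppr0 ?oppr_eq0//.
  under eq_bigr do rewrite mxE mulNr.
  by rewrite sumrN oppr_ge0 ltW.
have rel j : \sum_k c 0 k * rcoord (rank1mx (x k)) j = 0.
  have /rowP/(_ (enum_rank j)) := cM; rewrite !mxE.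
  by under eq_bigr do rewrite [M _ _]mxE enum_rankK.
(* If all coefficients were nonpositive, the nonnegative weighted sum [sc] would vanish term by
   term, and a nonzero coefficient would force its atom to be zero, which [xn0] excludes. *)
have [k0 ck0] : exists k, 0 < c 0 k.
  apply: contrapT => /forallNP cle.
  have {}cle k : c 0 k <= 0 by rewrite leNgt; apply/negP/cle.
  have : \sum_k c 0 k * l1norm (x k) ^+ 2 == 0.
    rewrite eq_le sc andbT; apply: sumr_le0 => k _.
    by rewrite mulr_le0_ge0// sqr_ge0.
  rewrite -oppr_eq0 -sumrN psumr_eq0 => [/allP all0|k _]; last first.
    by rewrite oppr_ge0 mulr_le0_ge0// sqr_ge0.
  have /rV0Pn[k ck] := c0.
  have := all0 k (mem_index_enum _); rewrite /= oppr_eq0 mulf_eq0 (negbTE ck) /=.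
  by rewrite expf_eq0 /= => /eqP/l1norm_eq0 xk0; apply: xn0; exists k.
pose k := [arg max_(k > k0) c 0 k]%O.
have cmax j : c 0 j <= c 0 k.
  by rewrite /k; case: arg_maxP => // i _; exact.
have ck : 0 < c 0 k by exact: lt_le_trans (cmax k0).
(* Maximality of [c 0 k] makes all weights nonnegative, with weight 0 at [k]. The relation keeps the
   sum fixed, while the mass drops by the quantity in [sc] divided by [c 0 k]. *)
pose w j := 1 - c 0 j / c 0 k.
have w0 j : 0 <= w j by rewrite subr_ge0 ler_pdivrMr// mul1r.
exists (fun j => (Num.sqrt (w j))%:C *: x j), k; split.
- by rewrite /w divff ?gt_eqF// subrr sqrtr0 scale0r.
- apply: rcoord_inj => j; rewrite /atom_sum !rcoord_sum.
  under eq_bigr do rewrite rank1mx_sqrtZ// rcoordZ /w mulrBl mul1r mulrAC.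
  by rewrite sumrB -mulr_suml rel mul0r subr0.
- rewrite /atom_mass; under eq_bigr do rewrite l1norm_sqrtZ// /w mulrBl mul1r mulrAC.
  by rewrite sumrB -mulr_suml lerBlDr lerDl divr_ge0// ltW.
Qed.

Lemma atom_pad N (x : 'I_N -> 'cV[R[i]]_n) D : (N <= D)%N ->
  exists y : 'I_D -> 'cV[R[i]]_n, atom_sum y = atom_sum x /\ atom_mass y = atom_mass x.
Proof.
move=> /subnKC <-; exists (fun k => if fintype.split k is inl j then x j else 0).
rewrite /atom_sum /atom_mass !big_split_ord /=; split.
  rewrite [X in _ + X]big1 ?addr0; last first.
    by move=> k _; rewrite (unsplitK (inr k)) rank1mx0.
  by apply: eq_bigr => k _; rewrite (unsplitK (inl k)).
rewrite [X in _ + X]big1 ?addr0; last first.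
  by move=> k _; rewrite (unsplitK (inr k)) l1norm0 expr0n.
by apply: eq_bigr => k _; rewrite (unsplitK (inl k)).
Qed.

(** Induction on the number of atoms: a short family is padded with zeros, and in a long one an atom
    is made to vanish and dropped. The fixed index type obtained is what compactness requires. *)
Lemma atom_caratheodory N (x : 'I_N -> 'cV[R[i]]_n) :
  exists y : 'I_#|{: 'I_n * 'I_n * bool}| -> 'cV[R[i]]_n,
    atom_sum y = atom_sum x /\ atom_mass y <= atom_mass x.
Proof.
elim: N x => [|N IH] x.
  have [y [yx yxm]] := atom_pad _ x _ (leq0n #|{: 'I_n * 'I_n * bool}|).
  by exists y; rewrite yx yxm.
have [ltN|leN] := ltnP #|{: 'I_n * 'I_n * bool}| N.+1; last first.
  by have [y [yx yxm]] := atom_pad _ x _ leN; exists y; rewrite yx yxm.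
have [y [k [yk <- yx]]] := atom_vanish _ x ltN.
have [z [zs zy]] := IH (y \o lift k); exists z; rewrite zs.
by have [-> e] := atom_drop _ y k yk; split=> //; rewrite -e in yx; exact: le_trans yx.
Qed.

End Atoms.

(** * Compactness and minimization over families of atoms *)

Section Compactness.
Context {R : realType} {n N : nat}.
Local Notation coords := ('I_N * 'I_n * bool)%type.

(** Families of [N] vectors are encoded as real row vectors, where closed bounded boxes are compact
    and the extreme value theorem applies. *)
Definition atoms_of_row (v : 'rV[R]_#|{: coords}|) (k : 'I_N) : 'cV[R[i]]_n :=
  \col_i (v 0 (enum_rank (k, i, false)) +i* v 0 (enum_rank (k, i, true))).

Definition row_of_atoms (x : 'I_N -> 'cV[R[i]]_n) : 'rV[R]_#|{: coords}| :=
  \row_j let: (k, i, b) := enum_val j in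
    if b then complex.Im (x k i 0) else complex.Re (x k i 0).

Lemma row_of_atomsK : cancel row_of_atoms atoms_of_row.
Proof.
move=> x; apply/funext => k; apply/matrixP => i j; rewrite !mxE !enum_rankK.
by rewrite ord1; case: (x k i 0).
Qed.

Lemma sumr_continuous (T : topologicalType) (I : Type) (r : seq I) (P : pred I)
    (F : I -> T -> R) :
  (forall i, P i -> continuous (F i)) ->
  continuous (fun t => \sum_(i <- r | P i) F i t).
Proof. by move=> cF; apply: continuous_big => //; exact: add_continuous. Qed.

Lemma funM_continuous (T : topologicalType) (f g : T -> R) :
  continuous f -> continuous g -> continuous (fun t => f t * g t).
Proof. by move=> cf cg t; exact: (continuousM (cf t) (cg t)). Qed.

Lemma funB_continuous (T : topologicalType) (f g : T -> R) :
  continuous f -> continuous g -> continuous (fun t => f t - g t).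
Proof. by move=> cf cg t; exact: (continuousB (cf t) (cg t)). Qed.

Lemma funD_continuous (T : topologicalType) (f g : T -> R) :
  continuous f -> continuous g -> continuous (fun t => f t + g t).
Proof. by move=> cf cg t; exact: (continuousD (cf t) (cg t)). Qed.

Lemma funX2_continuous (T : topologicalType) (f : T -> R) :
  continuous f -> continuous (fun t => f t ^+ 2).
Proof. by move=> cf; under eq_fun do rewrite expr2; exact: funM_continuous. Qed.

Lemma atom_mass_continuous : continuous (fun v => atom_mass (atoms_of_row v)).
Proof.
apply: sumr_continuous => k _; apply: funX2_continuous.
apply: sumr_continuous => i _; under eq_fun do rewrite normcE mxE /=.
move=> v; apply: (@continuous_comp _ _ _ (fun v : 'rV[R]__ =>
  v 0 (enum_rank (k, i, false)) ^+ 2 + v 0 (enum_rank (k, i, true)) ^+ 2) Num.sqrt).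
  by apply: funD_continuous; apply: funX2_continuous; exact: coord_continuous.
exact: sqrt_continuous.
Qed.

Lemma atom_sum_continuous j : continuous (fun v => rcoord (atom_sum (atoms_of_row v)) j).
Proof.
under eq_fun do rewrite rcoord_sum.
apply: sumr_continuous => k _; case: j => -[i j] []; rewrite /rcoord /=.
  under eq_fun do rewrite rank1mxE ImMconj !mxE /=.
  by apply: funB_continuous; apply: funM_continuous; exact: coord_continuous.
under eq_fun do rewrite rank1mxE ReMconj !mxE /=.
by apply: funD_continuous; apply: funM_continuous; exact: coord_continuous.
Qed.

Lemma atoms_of_row_le (m : R) (v : 'rV[R]_#|{: coords}|) j :
  atom_mass (atoms_of_row v) <= m -> `|v 0 j| <= m + 1.
Proof.
move=> vm; rewrite -(enum_valK j); case: (enum_val j) => -[k i] b.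
have km : l1norm (atoms_of_row v k) ^+ 2 <= m.
  apply: le_trans vm; rewrite /atom_mass (bigD1 k) //= lerDl.
  by apply: sumr_ge0 => ? _; exact: sqr_ge0.
(* From [t <= t ^+ 2 + 1], which avoids a square root of [m]. *)
have l1m : l1norm (atoms_of_row v k) <= m + 1 by nra.
apply: le_trans l1m; apply: le_trans (normc_le_l1norm _ _ i).
rewrite normcE mxE /= -sqrtr_sqr ler_sqrt; last by rewrite addr_ge0// sqr_ge0.
by case: b; rewrite (lerDl, lerDr) sqr_ge0.
Qed.

(** A bound on the mass confines the coordinates to a box, so the admissible rows form a compact
    set. It serves twice: to minimize the mass among decompositions of [A], and the distance to [A]
    among all families of bounded mass. *)
Lemma atoms_min (m : R) (P : ('I_N -> 'cV[R[i]]_n) -> Prop)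
    (f : ('I_N -> 'cV[R[i]]_n) -> R) :
  closed [set v | P (atoms_of_row v)] ->
  continuous (fun v => f (atoms_of_row v)) ->
  (exists2 x, P x & atom_mass x <= m) ->
  exists x, [/\ P x, atom_mass x <= m &
    forall y, P y -> atom_mass y <= m -> f x <= f y].
Proof.
move=> cP cf [x0 Px0 x0m].
pose K := [set v | P (atoms_of_row v)] `&` [set v | atom_mass (atoms_of_row v) <= m].
have Kcompact : compact K.
  have boxc : compact [set v : 'rV[R]_#|{: coords}| |
      forall j, v ord0 j \in `[(- (m + 1)), (m + 1)]].
    apply: (@rV_compact _ _ (fun=> `[(- (m + 1)), (m + 1)]%classic)).
    by move=> _; exact: segment_compact.
  apply: subclosed_compact _ boxc _ => [|v [_ vm] j]; last first.
    by rewrite in_itv /= -ler_norml; exact: atoms_of_row_le.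
  apply: closedI => //.
  apply: (@preimage_closed _ _ (fun v => atom_mass (atoms_of_row v)) [set r | r <= m]).
    by move=> v _; exact: atom_mass_continuous.
  exact: closed_le.
have K0 : K !=set0 by exists (row_of_atoms x0); rewrite /K /= row_of_atomsK.
have [c /set_mem[Pc cm] cmin] := EVT_min_rV K0 Kcompact (continuous_subspaceT cf).
exists (atoms_of_row c); split => // y Py ym.
by rewrite -(row_of_atomsK y); apply: cmin; rewrite inE /K /= row_of_atomsK.
Qed.

(** The squared Frobenius distance from [A] to the sum of the atoms. *)
Definition atom_dist (A : 'M[R[i]]_n) (x : 'I_N -> 'cV[R[i]]_n) : R :=
  \sum_j (rcoord A j - rcoord (atom_sum x) j) ^+ 2.

Lemma atom_dist_continuous A : continuous (fun v => atom_dist A (atoms_of_row v)).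
Proof.
apply: sumr_continuous => j _; apply: funX2_continuous.
by apply: funB_continuous; [exact: cst_continuous|exact: atom_sum_continuous].
Qed.

Lemma atom_dist_eq0 A x : atom_dist A x = 0 <-> A = atom_sum x.
Proof.
split=> [/eqP|->]; last by rewrite /atom_dist big1// => j _; rewrite subrr expr0n.
rewrite psumr_eq0 => [/allP d0|j _]; last exact: sqr_ge0.
apply: rcoord_inj => j; apply/eqP.
by have := d0 j (mem_index_enum _); rewrite /= sqrf_eq0 subr_eq0.
Qed.

Lemma atom_mass_min A (x : 'I_N -> 'cV[R[i]]_n) : A = atom_sum x ->
  exists2 y : 'I_N -> 'cV[R[i]]_n, A = atom_sum y &
    forall z : 'I_N -> 'cV[R[i]]_n, A = atom_sum z -> atom_mass y <= atom_mass z.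
Proof.
move=> Ax.
have [||| y [Ay yx ymin]] := atoms_min (atom_mass x)
  (fun y => A = atom_sum y) atom_mass.
- rewrite (_ : [set _ | _] = (fun v => atom_dist A (atoms_of_row v)) @^-1` [set 0]).
    apply: preimage_closed; last exact: closed_eq.
    by move=> v _; exact: atom_dist_continuous.
  by apply/seteqP; split => v /atom_dist_eq0.
- exact: atom_mass_continuous.
- by exists x.
(* The search was limited to masses at most that of [x]; a heavier [z] loses to [y] anyway. *)
exists y => // z Az; have [/(ymin z Az)//|/ltW] := leP (atom_mass z) (atom_mass x).
exact: le_trans.
Qed.

End Compactness.

(** * Projection onto the sums of atoms of bounded mass *)

Section NearestPoint.
Context {R : realType} {n : nat}.

Lemma atom_convex N N' (x : 'I_N -> 'cV[R[i]]_n) (y : 'I_N' -> 'cV[R[i]]_n) (t : R) :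
  0 <= t <= 1 -> exists z : 'I_(N + N') -> 'cV[R[i]]_n,
    atom_sum z = (1 - t)%:C *: atom_sum x + t%:C *: atom_sum y /\
    atom_mass z = (1 - t) * atom_mass x + t * atom_mass y.
Proof.
move=> /andP[t0 t1]; have {t1}t1 : 0 <= 1 - t by rewrite subr_ge0.
exists (fun k => match fintype.split k with
  | inl i => (Num.sqrt (1 - t))%:C *: x i | inr i => (Num.sqrt t)%:C *: y i end).
rewrite /atom_sum /atom_mass !big_split_ord /= !scaler_sumr !mulr_sumr.
split; congr (_ + _); apply: eq_bigr => k _.
- by rewrite (unsplitK (inl k)) rank1mx_sqrtZ.
- by rewrite (unsplitK (inr k)) rank1mx_sqrtZ.
- by rewrite (unsplitK (inl k)) l1norm_sqrtZ.
- by rewrite (unsplitK (inr k)) l1norm_sqrtZ.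
Qed.

Lemma le0_of_quadratic (l q : R) : 0 <= q ->
  (forall t, 0 <= t <= 1 -> 2 * t * l <= t ^+ 2 * q) -> l <= 0.
Proof.
move=> q0 h; rewrite leNgt; apply/negP => l0.
have lq : 0 < l + q by rewrite ltr_pwDl.
(* For [t = l / (l + q)] one has [t * q = l - t * l < l], against [2 * l <= t * q]. *)
have t01 : 0 <= l / (l + q) <= 1.
  by rewrite divr_ge0 ?(ltW l0) ?(ltW lq)//= ler_pdivrMr// mul1r lerDl.
have := h _ t01; have := divfK (lt0r_neq0 lq) l.
have : 0 < l / (l + q) by rewrite divr_gt0.
set t := l / _ => t0 tE; nra.
Qed.

(* Variational inequality of the projection of [A] onto the compact convex set
   of the sums of atoms of mass at most [M]. *)
Lemma atom_nearest (A : 'M[R[i]]_n) (M : R) : 0 <= M ->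
  exists2 x : 'I_#|{: 'I_n * 'I_n * bool}| -> 'cV[R[i]]_n, atom_mass x <= M &
    forall N (y : 'I_N -> 'cV[R[i]]_n), atom_mass y <= M ->
      \sum_j rcoord (A - atom_sum x) j * rcoord (atom_sum y) j <=
      \sum_j rcoord (A - atom_sum x) j * rcoord (atom_sum x) j.
Proof.
move=> M0.
have [|||x [_ xM xmin]] := @atoms_min R n #|{: 'I_n * 'I_n * bool}| M
    (fun=> True) (atom_dist A).
- by rewrite (_ : [set _ | _] = setT); [exact: closedT|exact/seteqP].
- exact: atom_dist_continuous.
- exists (fun=> 0) => //; rewrite /atom_mass big1// => k _.
  by rewrite l1norm0 expr0n.
exists x => // N y yM; rewrite -subr_le0 -sumrB.
apply: (@le0_of_quadratic _
  (\sum_j (rcoord (atom_sum y) j - rcoord (atom_sum x) j) ^+ 2)).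
  by apply: sumr_ge0 => j _; exact: sqr_ge0.
move=> t /[dup] t01 /(atom_convex _ _ x y)[z [zs zm]].
(* The convex combination [z] uses too many atoms to compete with [x]; the reduction restores the
   fixed number. *)
have [w [ws wz]] := atom_caratheodory _ z.
have wM : atom_mass w <= M by apply: le_trans wz _; rewrite zm; nra.
have := xmin w I wM; rewrite /atom_dist ws zs => h.
(* Expanding the squared distance at parameter [t] leaves exactly the linear and quadratic terms in
   [t] of the goal. *)
rewrite -subr_ge0 !mulr_sumr -sumrB; rewrite -subr_ge0 -sumrB in h.
apply: le_trans h _; apply: ler_sum => j _.
by rewrite rcoordB rcoordD !rcoordZ le_eqVlt; apply/orP; left; apply/eqP; ring.
Qed.

End NearestPoint.

(** * Borel measurability of the matrix entries on the sphere *)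

Section SphereIntegration.
Context {R : realType} {n : nat}.
Local Notation sphere := (borelSigma1 R n).

Lemma Re_continuous : continuous (@complex.Re R : R[i] -> R).
Proof.
move=> z U [e e0 eU]; exists e%:C; first by rewrite /= ltcR.
move=> w zw; apply: eU; move: zw; rewrite /= -ltcR; apply: le_lt_trans.
by apply: le_trans (normc_ge_Re _); case: (z) (w) => [? ?] [? ?].
Qed.

Lemma Im_continuous : continuous (@complex.Im R : R[i] -> R).
Proof.
move=> z U [e e0 eU]; exists e%:C; first by rewrite /= ltcR.
move=> w zw; apply: eU; move: zw; rewrite /= -ltcR; apply: le_lt_trans.
(* Multiplication by ['i] preserves the modulus and turns the imaginary part into the real part up
   to sign. *)
have := normc_ge_Re ((z - w) * 'i); rewrite ReiNIm normrN normrM normCi mulr1.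
by apply: le_trans; case: (z) (w) => [? ?] [? ?].
Qed.

Lemma continuous_measurable_sphere (f : Sigma1 R n -> R) :
  continuous f -> measurable_fun setT (f : sphere -> R).
Proof.
move=> /continuousP cf; apply: (measurability _ (RGenOpens.measurableE R)).
move=> _ [_ [a [b ->] <-]]; rewrite setTI; apply: sub_sigma_algebra.
exact/cf/interval_open.
Qed.

Lemma sphere_coord_continuous i :
  continuous (fun x : Sigma1 R n => Sigma1_val x i 0).
Proof.
move=> x; apply: (@continuous_comp _ _ _ (@Sigma1_val R n) (fun v => v i 0)).
  exact: initial_continuous.
exact: coord_continuous.
Qed.

Lemma measurable_sphere_rank1 j :
  measurable_fun setT (fun x : sphere => rcoord (rank1mx (Sigma1_val x)) j).
Proof.
have mRe i : measurable_fun setT (fun x : sphere => complex.Re (Sigma1_val x i 0)).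
  apply: continuous_measurable_sphere => x.
  apply: (@continuous_comp _ _ _ (fun x : Sigma1 R n => Sigma1_val x i 0) (@complex.Re R)).
    exact: sphere_coord_continuous.
  exact: Re_continuous.
have mIm i : measurable_fun setT (fun x : sphere => complex.Im (Sigma1_val x i 0)).
  apply: continuous_measurable_sphere => x.
  apply: (@continuous_comp _ _ _ (fun x : Sigma1 R n => Sigma1_val x i 0) (@complex.Im R)).
    exact: sphere_coord_continuous.
  exact: Im_continuous.
case: j => -[i j] []; rewrite /rcoord /=.
  under eq_fun do rewrite rank1mxE ImMconj.
  by apply: measurable_funB; apply: measurable_funM.
under eq_fun do rewrite rank1mxE ReMconj.
by apply: measurable_funD; apply: measurable_funM.
Qed.

End SphereIntegration.

(** * From representing measures to finite decompositions *)

Section Barycenter.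
Context {R : realType} {n : nat}.
Local Notation sphere := (borelSigma1 R n).
Implicit Types (A : 'M[R[i]]_n.+1) (mu : {finite_measure set sphere -> \bar R}).

Lemma l1norm_sphere (x : sphere) : l1norm (Sigma1_val x) = 1.
Proof. by case: x => x xs; have := set_mem xs. Qed.

Lemma sqr_normc_sphere_le1 (x : sphere) i :
  complex.Re (Sigma1_val x i 0) ^+ 2 + complex.Im (Sigma1_val x i 0) ^+ 2 <= 1.
Proof.
have := normc_le_l1norm _ (Sigma1_val x) i.
rewrite l1norm_sphere normcE -[X in _ <= X]sqrtr1 ler_sqrt//.
Qed.

Lemma rcoord_sphere_le (x : sphere) j : `|rcoord (rank1mx (Sigma1_val x)) j| <= 1.
Proof.
case: j => -[i j] b; have := sqr_normc_sphere_le1 x i; have := sqr_normc_sphere_le1 x j.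
rewrite /rcoord /= rank1mxE ReMconj ImMconj.
case: (Sigma1_val x i 0) (Sigma1_val x j 0) => [p q] [r s] /= h1 h2.
(* Applied to the two products making up a coordinate, this bounds twice its absolute value by the
   sum of two squared moduli, hence by 2. *)
have h (t u : R) : - (t ^+ 2 + u ^+ 2) <= 2 * (t * u) <= t ^+ 2 + u ^+ 2.
  have := sqr_ge0 (t - u); have := sqr_ge0 (t + u).
  by rewrite sqrrD sqrrB => ? ?; apply/andP; split; lra.
have /andP[? ?] := h p r; have /andP[? ?] := h q s.
have /andP[? ?] := h q r; have /andP[? ?] := h p s.
by rewrite ler_norml; case: b; apply/andP; split; lra.
Qed.

Lemma integrable_sphere_rank1 mu j :
  mu.-integrable setT (EFin \o fun x => rcoord (rank1mx (Sigma1_val x)) j).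
Proof.
apply: measurable_bounded_integrable => //.
- by rewrite ltey_eq fin_num_measure.
- exact: measurable_sphere_rank1.
- by exists 1; split => // M M1 x _; apply: le_trans (ltW M1); exact: rcoord_sphere_le.
Qed.

Lemma represents_rcoordP A mu : represents A mu <->
  forall j, rcoord A j =
    (\int[mu]_x rcoord (rank1mx (Sigma1_val x)) j)%R.
Proof.
split=> [-> [[i j] b]|h].
  by rewrite /rcoord /mxintegral mxE /Cintegral /=; case: b.
apply: rcoord_inj => -[[i j] b]; rewrite h.
by rewrite /rcoord /mxintegral mxE /Cintegral /=; case: b.
Qed.

Lemma total_massE mu : total_mass mu = mu setT.
Proof. by rewrite /total_mass integral_cst// mul1e. Qed.

Lemma Rintegral_linear_sphere mu (c : 'I_n.+1 * 'I_n.+1 * bool -> R) :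
  (\int[mu]_x \sum_j c j * rcoord (rank1mx (Sigma1_val x)) j)%R =
  \sum_j c j * (\int[mu]_x rcoord (rank1mx (Sigma1_val x)) j)%R.
Proof.
rewrite /Rintegral; under eq_integral do rewrite -sumEFin.
have int_c j : mu.-integrable setT
    (fun x => (c j * rcoord (rank1mx (Sigma1_val x)) j)%:E).
  under eq_fun do rewrite EFinM.
  by apply: integrableZl => //; exact: integrable_sphere_rank1.
rewrite integral_sum//; under eq_bigr => j _.
  under eq_integral do rewrite EFinM.
  rewrite integralZl//; last exact: integrable_sphere_rank1.
  over.
have fin j : (\int[mu]_x (rcoord (rank1mx (Sigma1_val x)) j)%:E \is a fin_num)%E.
  by apply: integrable_fin_num => //; exact: integrable_sphere_rank1.
rewrite -sum_fine => [|j _]; last by rewrite fin_numM.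
by apply: eq_bigr => j _; rewrite fineM.
Qed.

Lemma integrable_linear_sphere mu (c : 'I_n.+1 * 'I_n.+1 * bool -> R) :
  mu.-integrable setT
    (EFin \o fun x => \sum_j c j * rcoord (rank1mx (Sigma1_val x)) j).
Proof.
rewrite (_ : _ \o _ = fun x => (\sum_j (c j)%:E * (rcoord (rank1mx (Sigma1_val x)) j)%:E)%E).
  apply: integrable_sum => // j _.
  by apply: integrableZl => //; exact: integrable_sphere_rank1.
by apply/funext => x /=; rewrite -sumEFin.
Qed.

Lemma represents_atoms A mu (M : R) : 0 < M -> represents A mu ->
  (total_mass mu <= M%:E)%E ->
  exists2 x : 'I_#|{: 'I_n.+1 * 'I_n.+1 * bool}| -> 'cV[R[i]]_n.+1,
    A = atom_sum x & atom_mass x <= M.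
Proof.
move=> M0 /represents_rcoordP Amu muM.
have [x xM xnear] := atom_nearest A M (ltW M0); exists x => //.
set E := A - atom_sum x in xnear.
pose L X := \sum_j rcoord E j * rcoord X j.
(* Variational inequality tested on the empty family. *)
have Lx0 : 0 <= L (atom_sum x).
  have := xnear 0%N (fun=> 0); rewrite {1}/atom_mass big_ord0 => /(_ (ltW M0)).
  apply: le_trans; rewrite big1// => j _.
  by rewrite /atom_sum big_ord0 rcoord0 mulr0.
(* Tested on the single atom at [p] rescaled to the full mass [M]; this is where [M] must be
   positive. *)
have LE p : L (rank1mx (Sigma1_val p)) <= L (atom_sum x) / M.
  have := xnear 1%N (fun=> (Num.sqrt M)%:C *: Sigma1_val p).
  rewrite {1}/atom_mass /atom_sum !big_ord1 l1norm_sqrtZ ?(ltW M0)//.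
  rewrite l1norm_sphere expr1n mulr1 => /(_ (lexx _)).
  rewrite rank1mx_sqrtZ ?(ltW M0)// ler_pdivlMr// mulrC /L mulr_sumr.
  apply: le_trans; rewrite le_eqVlt; apply/orP; left; apply/eqP.
  by apply: eq_bigr => j _; rewrite rcoordZ mulrCA.
(* Integrating [LE] against [mu] gives [L (atom_sum x)] times the ratio of the total mass to [M];
   that ratio is at most 1, and [Lx0] allows dropping it. *)
have LA : L A <= L (atom_sum x).
  have -> : L A = (\int[mu]_q L (rank1mx (Sigma1_val q)))%R.
    by rewrite Rintegral_linear_sphere; apply: eq_bigr => j _; rewrite Amu.
  apply: (@le_trans _ _ (\int[mu]_q (L (atom_sum x) / M))%R).
    apply: le_Rintegral => //; first exact: integrable_linear_sphere.
    by apply/finite_measure_integrable_cst.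
  rewrite Rintegral_cst// -mulrA ler_piMr// mulrC ler_pdivrMr// mul1r.
  rewrite -lee_fin fineK ?fin_num_measure//.
  by move: muM; rewrite total_massE.
apply: rcoord_inj => j; apply/eqP; rewrite -subr_eq0 -rcoordB.
(* The sum of squares is [L A - L (atom_sum x)], so [LA] makes it nonpositive. *)
have : \sum_j rcoord E j ^+ 2 == 0.
  rewrite eq_le sumr_ge0 ?andbT => [|? _]; last exact: sqr_ge0.
  rewrite -subr_le0 -sumrB in LA; apply: le_trans LA.
  rewrite le_eqVlt; apply/orP; left; apply/eqP; apply: eq_bigr => k _.
  by rewrite -mulrBr -rcoordB expr2.
rewrite psumr_eq0 => [/allP/(_ j (mem_index_enum _))|k _]; last exact: sqr_ge0.
by rewrite /= sqrf_eq0.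
Qed.

End Barycenter.

(** * Integration against finitely supported measures *)

Section DiscreteMeasure.
Context {d : measure_display} {T : measurableType d} {R : realType}.
Variables (w : nat -> {nonneg R}) (p : nat -> T) (N : nat).

Definition diracs := msum (fun k => mscale (w k) \d_(p k)) N.

HB.instance Definition _ := Measure.on diracs.

Let diracs_finite : fin_num_fun diracs.
Proof.
move=> U mU; rewrite /diracs /msum; apply/sum_fin_numP => k _ _.
exact: (@fin_num_measure _ _ _ (mscale (w k) \d_(p k))).
Qed.

HB.instance Definition _ := Measure_isFinite.Build _ _ _ diracs diracs_finite.

Lemma ge0_integral_diracs (g : T -> R) : measurable_fun setT g ->
  (forall x, 0 <= g x) ->
  (\int[diracs]_x (g x)%:E = (\sum_(k < N) (w k)%:num * g (p k))%:E)%E.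
Proof.
move=> mg g0; rewrite ge0_integral_measure_sum//; first last.
- exact/measurable_EFinP.
- by move=> x _; rewrite lee_fin.
rewrite -sumEFin; apply: eq_bigr => k _.
rewrite ge0_integral_mscale//; first last.
- by move=> x _; rewrite lee_fin.
- exact/measurable_EFinP.
rewrite integral_dirac//; last exact/measurable_EFinP.
by rewrite diracT mul1e EFinM.
Qed.

Lemma Rintegral_diracs (g : T -> R) : measurable_fun setT g ->
  (\int[diracs]_x g x)%R = \sum_(k < N) (w k)%:num * g (p k).
Proof.
(* Reduction to the nonnegative case through positive and negative parts. *)
move=> mg; rewrite /Rintegral integralE.
have -> : ((fun x => (g x)%:E) ^\+ = fun x => (Num.max (g x) 0)%:E)%E.
  by apply/funext => x; rewrite funeposE EFin_max.
have -> : ((fun x => (g x)%:E) ^\- = fun x => (Num.max (- g x) 0)%:E)%E.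
  by apply/funext => x; rewrite funenegE EFin_max.
rewrite !ge0_integral_diracs; first last.
- by move=> x; rewrite le_max lexx orbT.
- by apply: measurable_maxr.
- by move=> x; rewrite le_max lexx orbT.
- by apply: measurable_maxr => //; exact: measurable_funN.
have maxB (r : R) : r = Num.max r 0 - Num.max (- r) 0.
  by have [r0|r0] := leP 0 r; [rewrite (max_idPr _)|rewrite (max_idPl _)]; lra.
rewrite /= -sumrB; apply: eq_bigr => k _.
by rewrite [in RHS](maxB (g (p k))) mulrBr.
Qed.

Lemma diracsT : diracs setT = (\sum_(k < N) (w k)%:num)%:E.
Proof.
rewrite /diracs /msum -sumEFin; apply: eq_bigr => k _.
by transitivity ((w k)%:num%:E * \d_(p k) setT)%E; [|rewrite diracT mule1].
Qed.

End DiscreteMeasure.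

(** * From finite decompositions to representing measures, and existence of a decomposition *)

Section SphereAtoms.
Context {R : realType} {n : nat}.
Local Notation sphere := (borelSigma1 R n).
Implicit Types (A : 'M[R[i]]_n.+1) (mu : {finite_measure set sphere -> \bar R}).

Lemma l1norm_polar (x : 'cV[R[i]]_n.+1) :
  exists q : sphere, x = (l1norm x)%:C *: Sigma1_val q.
Proof.
have [x0|x0] := eqVneq (l1norm x) 0.
  (* The zero vector has no direction; with coefficient 0 any point of the sphere serves. *)
  by exists point; rewrite (l1norm_eq0 _ _ x0) l1norm0 scale0r.
have xgt0 : 0 < l1norm x by rewrite lt_neqAle eq_sym x0 l1norm_ge0.
have nx : ((l1norm x)^-1)%:C *: x \in @l1sphere R n.+1.
  by rewrite inE /l1sphere /= l1normZ ?invr_ge0 ?l1norm_ge0// mulVf.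
exists (SigSub nx : set_type (@l1sphere R n.+1)).
by rewrite /Sigma1_val /= scalerA -rmorphM /= divff// scale1r.
Qed.

Lemma atoms_represents N (x : 'I_N -> 'cV[R[i]]_n.+1) :
  exists mu, represents (atom_sum x) mu /\ total_mass mu = (atom_mass x)%:E.
Proof.
have /choice[q xq] := fun k => l1norm_polar (x k).
(* The defaults, weight 0 and an arbitrary point, lie outside the range [k < N] over which [diracs]
   sums. *)
pose w (k : nat) : {nonneg R} :=
  if insub k is Some i then NngNum (sqr_ge0 (l1norm (x i))) else NngNum (lexx 0).
pose p (k : nat) : sphere := if insub k is Some i then q i else point.
exists (diracs w p N); rewrite total_massE; split.
  apply/represents_rcoordP => j; rewrite Rintegral_diracs; last first.
    exact: measurable_sphere_rank1.
  rewrite /atom_sum rcoord_sum; apply: eq_bigr => k _.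
  rewrite /w /p valK /= -rcoordZ -rank1mx_sqrtZ ?sqr_ge0//.
  by rewrite sqrtr_sqr ger0_norm ?l1norm_ge0// -xq.
apply: (etrans (diracsT _ _ _)); congr (_%:E).
by apply: eq_bigr => k _; rewrite /w valK.
Qed.

Lemma psdmx_atoms A : psdmx A ->
  exists x : 'I_n.+1 -> 'cV[R[i]]_n.+1, A = atom_sum x.
Proof.
move=> [Aherm Apos].
have /orthomx_spectralP := hermitian_normalmx Aherm.
set P := spectralmx A; set s := spectral_diag A => AE.
have Pu : P \is unitarymx by exact: spectral_unitarymx.
rewrite invmx_unitary// in AE.
(* By unitarity of [P], the eigenvalue is the quadratic form of [A] at the adjoint of row [k] of
   [P]. *)
have s_ge0 k : 0 <= s 0 k.
  have PP : P *m P^t* = 1%:M by exact/unitarymxP.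
  have := Apos ((row k P)^t*); rewrite trmxCK AE rowE trmx_mul map_mxM.
  rewrite !mulmxA -(mulmxA _ P) PP mulmx1 -(mulmxA _ P) PP mulmx1.
  by rewrite trmx_delta map_delta_mx -colE -rowE !mxE eqxx.
exists (fun k => (Num.sqrt (complex.Re (s 0 k)))%:C *: (row k P)^t*).
apply/matrixP => i j; rewrite {1}AE /atom_sum mxE summxE; apply: eq_bigr => k _.
(* Nonnegativity in [R[i]] includes a zero imaginary part, so [s 0 k] equals its real part. *)
have := s_ge0 k; rewrite lecE => /andP[/eqP sIm sRe].
rewrite rank1mx_sqrtZ// mul_mx_diag !mxE big_ord1 !mxE conjCK.
have -> : (complex.Re (s 0 k))%:C = s 0 k.
  by apply/eqP; rewrite eq_complex /= sIm !eqxx.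
by rewrite mulrCA mulrA.
Qed.

End SphereAtoms.

Theorem theorem3p1 (R : realType) (n : nat) (A : 'M[R[i]]_n.+1) (hA : psdmx A) :
  gamma_plus A = ereal_inf [set total_mass mu | mu in represents A] /\
  (exists mu : {finite_measure set (borelSigma1 R n) -> \bar R},
     represents A mu /\
     total_mass mu = ereal_inf [set total_mass nu | nu in represents A]).
Proof.
have [x Ax] := psdmx_atoms A hA.
have [y [yx _]] := atom_caratheodory _ x.
(* Optimal among families of the fixed size only; [atom_caratheodory] extends this to all sizes. *)
have [z Az zmin] := atom_mass_min A y (etrans Ax (esym yx)).
have [mu [muA mass_mu]] := atoms_represents _ z; rewrite -Az in muA.
have infE : ereal_inf [set total_mass nu | nu in represents A] = (atom_mass z)%:E.
  apply/eqP; rewrite eq_le -{1}mass_mu ereal_inf_lbound ?andTb; last by exists mu.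
  (* The slack [e] keeps the mass bound given to [represents_atoms] positive even when [nu] has mass
     0. *)
  apply: le_ereal_inf_tmp => _ [nu nuA <-]; apply/lee_addgt0Pr => e e0.
  have nuT : total_mass nu \is a fin_num by rewrite total_massE fin_num_measure.
  have nu0 : 0 <= fine (total_mass nu) by rewrite fine_ge0// total_massE.
  have [||t At te] := represents_atoms A nu (fine (total_mass nu) + e) _ nuA _.
  - by rewrite ltr_wpDl.
  - by rewrite EFinD fineK// leeDl// lee_fin ltW.
  rewrite -(fineK nuT) -EFinD lee_fin; apply: le_trans te; exact: zmin.
rewrite infE; split; last by exists mu.
apply/eqP; rewrite eq_le; apply/andP; split.
  by apply: ereal_inf_lbound; exists #|{: 'I_n.+1 * 'I_n.+1 * bool}|, z.
apply: le_ereal_inf_tmp => _ [N [t [At ->]]]; rewrite lee_fin.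
have [t' [t'A t't]] := atom_caratheodory _ t.
by apply: le_trans t't; apply: zmin; rewrite t'A.
Qed.
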